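(* Let $(X,d)$ be a complete separable metric space with a fixed dense sequence $(x_i)_{i\in\mathbb{N}}$, let $T\colon X\to X$ be continuous and let $u\colon X\to\mathbb{R}$ be uniformly continuous. Let $x\in X$ with $0<\underline{u}(x)\le\overline{u}(x)<\infty$, let $A\subset\mathbb{N}$ be any oracle, and suppose $\varepsilon>0$ is admissible for $x$. Then: - If $\underline{K}^A(x,T,\varepsilon)<\infty$ then $s=\dim^A_{\mathrm{BS}}(x,T,u,\varepsilon)$ is the unique solution of $\underline{P}^A(x,T,-su,\varepsilon)=0$. - If $\overline{K}^A(x,T,\varepsilon)<\infty$ then $s=\mathrm{Dim}^A_{\mathrm{BS}}(x,T,u,\varepsilon)$ is the unique solution of $\overline{P}^A(x,T,-su,\varepsilon)=0$. - If $\underline{K}^A(x,T)<\infty$ then $s=\dim^A_{\mathrm{BS}}(x,T,u)$ is the unique solution of $\underline{P}^A(x,T,-su)=0$. - If $\overline{K}^A(x,T)<\infty$ then $s=\mathrm{Dim}^A_{\mathrm{BS}}(x,T,u)$ is the unique solution of $\overline{P}^A(x,T,-su)=0$.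
   Context: Dynamics: for $f\colon X\to\mathbb{R}$, $S_nf=\sum_{k=0}^{n-1}f\circ T^k$; $\underline{u}(x)=\liminf_n\frac1nS_nu(x)$, $\overline{u}(x)=\limsup_n\frac1nS_nu(x)$; $B_n(x,T,\varepsilon)=\{y\in X: d(T^ix,T^iy)<\varepsilon \text{ for } 0\le i<n\}$; $\mathrm{Var}(u,\varepsilon)=\sup\{|u(y)-u(z)|:d(y,z)\le\varepsilon\}$. Admissible scale: $\varepsilon>0$ is admissible for $x$ if $\mathrm{Var}(u,\varepsilon)<\underline{u}(x)/2$ and there is $N$ such that for all $n\ge N$ and all $x_i\in B_n(x,T,\varepsilon)$, $\underline{u}(x)-2\mathrm{Var}(u,\varepsilon)\le\frac{S_nu(x_i)}{n}\le\overline{u}(x)+2\mathrm{Var}(u,\varepsilon)$. Complexity: fix a universal prefix-free oracle machine $U$; $K^A(\sigma)=\min\{|\tau|:U^A(\tau)=\sigma\}$; natural numbers are identified with strings through a fixed computable coding. All minima are over indices $i$ with $x_i\in B_n(x,T,\varepsilon)$; $s$ is real. Define $\underline{K}^A(x,T,\varepsilon)=\liminf_{n\to\infty}\min_i\frac{K^A(i)}{n}$; $\underline{P}^A(x,T,\varphi,\varepsilon)=\liminf_{n\to\infty}\min_i\frac{K^A(i)+S_n\varphi(x_i)}{n}$ for uniformly continuous $\varphi\colon X\to\mathbb{R}$; $\dim^A_{\mathrm{BS}}(x,T,u,\varepsilon)=\liminf_{n\to\infty}\min_i\frac{K^A(i)}{S_nu(x_i)}$ (for $x$ with $\underline{u}(x)>0$).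 The quantities $\overline{K}^A(x,T,\varepsilon)$, $\overline{P}^A(x,T,\varphi,\varepsilon)$, $\mathrm{Dim}^A_{\mathrm{BS}}(x,T,u,\varepsilon)$ are the same with $\limsup_{n\to\infty}$. The quantities without $\varepsilon$ ($\underline{K}^A(x,T)$, $\overline{K}^A(x,T)$, $\underline{P}^A(x,T,\varphi)$, $\overline{P}^A(x,T,\varphi)$, $\dim^A_{\mathrm{BS}}(x,T,u)$, $\mathrm{Dim}^A_{\mathrm{BS}}(x,T,u)$) are the limits as $\varepsilon\to0$ of the corresponding quantities with $\varepsilon$. *)

(* Defs.v *)
From HB Require Import structures.
From mathcomp Require Import all_boot all_order all_algebra.
From mathcomp Require Import all_classical all_reals all_analysis.

Set Implicit Arguments.
Unset Strict Implicit.
Unset Printing Implicit Defensive.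

Import Order.TTheory GRing.Theory Num.Theory.
Import numFieldNormedType.Exports.

Local Open Scope classical_set_scope.
Local Open Scope ring_scope.

(* The library's complete spaces are pointed; this is harmless for a space
   that contains the point under study. *)
#[short(type="completeMetricType")]
HB.structure Definition CompleteMetric (R : numDomainType) :=
  {X of Complete X & Metric R X}.

(* Oracle machines are codes for partial recursive functions with one more
   basic function, the characteristic function of the oracle. Codes are
   untyped: a missing argument counts as 0, a superfluous one is ignored. *)
Inductive ocode : Type :=
| Zero
| Succ
| Proj of nat
| Query
| Comp of ocode & seq ocode
| Prec of ocode & ocode
| Mu of ocode.

(* oeval A c v r: with oracle A, the code c halts on arguments v with value r. *)
Inductive oeval (A : set nat) : ocode -> seq nat -> nat -> Prop :=
| EvZero v : oeval A Zero v 0%N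
| EvSucc v : oeval A Succ v (head 0%N v).+1
| EvProj j v : oeval A (Proj j) v (nth 0%N v j)
| EvQuery v : oeval A Query v (nat_of_bool `[< A (head 0%N v) >])
| EvComp f gs v w r : oevals A gs v w -> oeval A f w r ->
    oeval A (Comp f gs) v r
| EvPrec0 f g v r : oeval A f v r -> oeval A (Prec f g) (0%N :: v) r
| EvPrecS f g n v p r : oeval A (Prec f g) (n :: v) p ->
    oeval A g [:: n, p & v] r -> oeval A (Prec f g) (n.+1 :: v) r
| EvMu f v n (p : nat -> nat) : oeval A f (n :: v) 0%N ->
    (forall m, (m < n)%N -> oeval A f (m :: v) (p m).+1) ->
    oeval A (Mu f) v n
with oevals (A : set nat) : seq ocode -> seq nat -> seq nat -> Prop :=
| EvNil v : oevals A [::] v [::]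
| EvCons g gs v r w : oeval A g v r -> oevals A gs v w ->
    oevals A (g :: gs) v (r :: w).

(* The length-lexicographic numbering of binary strings: the string s has
   number k where k + 1 is written 1s in binary. *)
Definition nat_of_bits (s : seq bool) : nat :=
  (foldl (fun m (b : bool) => b + m.*2) 1 s)%N.-1.

Lemma nat_of_bits_rcons s b :
  nat_of_bits (rcons s b) = (b + (nat_of_bits s).*2.+1)%N.
Proof.
rewrite /nat_of_bits foldl_rcons.
have : (0 < foldl (fun m (c : bool) => c + m.*2) 1 s)%N.
  elim/last_ind: s => [//|s c]; rewrite foldl_rcons -double_gt0 => ?.
  by rewrite addn_gt0; apply/orP; right.
by case: foldl => [//|m] _ /=; rewrite doubleS !addnS.
Qed.

Lemma nat_of_bits_bij : bijective nat_of_bits.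
Proof.
have inj : injective nat_of_bits.
  elim/last_ind => [|s b IH]; elim/last_ind => [|t c _] //.
  - by rewrite nat_of_bits_rcons addnS.
  - by rewrite nat_of_bits_rcons addnS.
  rewrite !nat_of_bits_rcons !addnS => -[eq_st].
  have bc : b = c by have := congr1 odd eq_st; rewrite !oddD !odd_double !oddb !addbF.
  by move: eq_st; rewrite bc => /addnI /double_inj /IH ->.
have surj n : exists s, nat_of_bits s = n.
  elim/ltn_ind: n => -[|n] IH; first by exists [::].
  have [|s sE] := IH n./2; first by rewrite ltnS leq_half_double -addnn leqW ?leq_addr.
  by exists (rcons s (odd n)); rewrite nat_of_bits_rcons sE addnS odd_double_half.
exists (fun n => projT1 (cid (surj n))) => [s|n]; last by case: cid.
by apply: inj; case: cid.
Qed.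

Definition outputs (M : ocode) (A : set nat) (t s : seq bool) : Prop :=
  oeval A M [:: nat_of_bits t] (nat_of_bits s).

Definition prefix_free (D : set (seq bool)) : Prop :=
  forall s t, D s -> D t -> prefix s t -> s = t.

Definition prefix_free_machine (M : ocode) : Prop :=
  forall A, prefix_free [set t | exists s, outputs M A t s].

Definition universal_prefix_free (U : ocode) : Prop :=
  prefix_free_machine U /\
  forall M, prefix_free_machine M -> exists rho, forall A t s,
    outputs U A (rho ++ t) s <-> outputs M A t s.

Definition computable_coding (code : nat -> seq bool) : Prop :=
  bijective code /\
  exists c, forall n, oeval set0 c [:: n] (nat_of_bits (code n)).

(* A string without a description gets +oo; this does not happen when U is
   universal. *)
Definition oracleK {R : realType} (U : ocode) (A : set nat) (s : seq bool)
    : \bar R :=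
  ereal_inf [set (size t)%:R%:E | t in [set t | outputs U A t s]].

Section dynamics.
Context {R : realType} {X : metricType R} (T : X -> X).
Implicit Types (f u phi : X -> R) (x : X) (e : R).

Definition birkhoff f (n : nat) x : R := \sum_(k < n) f (iter k T x).

Definition lower_avg u x : \bar R :=
  limn_einf (fun n => (birkhoff u n x / n%:R)%:E).

Definition upper_avg u x : \bar R :=
  limn_esup (fun n => (birkhoff u n x / n%:R)%:E).

Definition bowen_ball (n : nat) x e : set X :=
  [set y | forall i, (i < n)%N -> mdist (iter i T x) (iter i T y) < e].

Definition Var u e : \bar R :=
  ereal_sup [set `|u yz.1 - u yz.2|%:E | yz in [set yz | mdist yz.1 yz.2 <= e]].

Variable xs : nat -> X.

Definition admissible u x e : Prop :=
  [/\ 0 < e, (Var u e < lower_avg u x / 2%:E)%E &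
    exists N, forall n, (N <= n)%N -> forall i, bowen_ball n x e (xs i) ->
      (lower_avg u x - 2%:E * Var u e <= (birkhoff u n (xs i) / n%:R)%:E
        <= upper_avg u x + 2%:E * Var u e)%E].

(* In the sequel K stands for the complexity of indices. The minimum over
   i is an infimum in \bar R (+oo when no x_i lies in the Bowen ball). *)
Variable K : nat -> \bar R.

Definition inf_bowen (n : nat) x e (F : nat -> \bar R) : \bar R :=
  ereal_inf [set F i | i in [set i | bowen_ball n x e (xs i)]].

Definition lowerK x e : \bar R :=
  limn_einf (fun n => inf_bowen n x e (fun i => K i / n%:R%:E)%E).

Definition upperK x e : \bar R :=
  limn_esup (fun n => inf_bowen n x e (fun i => K i / n%:R%:E)%E).

Definition lowerP phi x e : \bar R :=
  limn_einf (fun n => inf_bowen n x e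
    (fun i => (K i + (birkhoff phi n (xs i))%:E) / n%:R%:E)%E).

Definition upperP phi x e : \bar R :=
  limn_esup (fun n => inf_bowen n x e
    (fun i => (K i + (birkhoff phi n (xs i))%:E) / n%:R%:E)%E).

Definition dimBS u x e : \bar R :=
  limn_einf (fun n => inf_bowen n x e
    (fun i => K i / (birkhoff u n (xs i))%:E)%E).

Definition DimBS u x e : \bar R :=
  limn_esup (fun n => inf_bowen n x e
    (fun i => K i / (birkhoff u n (xs i))%:E)%E).

(* The limits below exist in \bar R: Bowen balls shrink with e, so all the
   quantities above are nonincreasing in e. *)
Definition lowerK0 x : \bar R := lim (lowerK x e @[e --> 0^'+]).
Definition upperK0 x : \bar R := lim (upperK x e @[e --> 0^'+]).
Definition lowerP0 phi x : \bar R := lim (lowerP phi x e @[e --> 0^'+]).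
Definition upperP0 phi x : \bar R := lim (upperP phi x e @[e --> 0^'+]).
Definition dimBS0 u x : \bar R := lim (dimBS u x e @[e --> 0^'+]).
Definition DimBS0 u x : \bar R := lim (DimBS u x e @[e --> 0^'+]).

End dynamics.

(* Main.v *)
Require Import Defs.
From mathcomp Require Import all_boot all_order all_algebra.
From mathcomp Require Import all_classical all_reals all_analysis.
From mathcomp Require Import ring lra.

Set Implicit Arguments.
Unset Strict Implicit.
Unset Printing Implicit Defensive.

Import Order.TTheory GRing.Theory Num.Theory.
Import numFieldNormedType.Exports.

Local Open Scope classical_set_scope.
Local Open Scope ring_scope.

(** For [x_i] in the Bowen ball write [S = S_n u(x_i)]. The identity

      [(K(i) - t S) / n = (S / n) (K(i) / S - t)]

    ties the pressure at [- t u] to the quotient that defines the dimension.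
    On an admissible scale [S / n] lies, for large [n], in a fixed interval
    [[c, C]] with [c > 0], so the left-hand side lies between two broken lines
    evaluated at [K(i) / S]: both vanish at [t] and have slopes [c] and [C] on
    the two sides of [t], in either order ([stretch_quotient]).

    Each broken line extends to an order isomorphism of the extended real
    line, and everything done afterwards to the two families (minimum over
    [i], lower or upper limit in [n], limit as the scale tends to 0, which is a
    supremum by monotonicity) is built from infima and suprema. Order
    isomorphisms commute with these, so the bounds survive: the dimension [D]
    and the pressure [P(t)] satisfy
    [stretch c C t D <= P(t) <= stretch C c t D] ([pressure_sandwich]).

    At [t = 0] the pressure is the complexity rate, so its finiteness forces
    [D < +oo]; and since a broken line vanishes only at [t], the equation
    [P(t) = 0] holds exactly when [t = D] ([stretch_root]). *)

(** * Order isomorphisms of the extended line *)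

Section OrderIso.
Context {R : realType}.
Implicit Types (f g : nat -> \bar R) (h : \bar R -> \bar R) (S : set (\bar R)).

(** A one-sided inverse is enough, since monotonicity in both directions makes
    [h] injective. *)
Definition order_iso h : Prop :=
  {mono h : x y / (x <= y)%E} /\ exists h', cancel h' h.

Lemma ereal_sup_order_iso h S : order_iso h ->
  ereal_sup (h @` S) = h (ereal_sup S).
Proof.
move=> [hle [h' h'K]]; apply/eqP; rewrite eq_le; apply/andP; split.
  by apply: ge_ereal_sup => _ [y Sy <-]; rewrite hle; exact: ereal_sup_ubound.
rewrite -[leRHS]h'K hle; apply: ge_ereal_sup => y Sy.
by rewrite -hle h'K; apply: ereal_sup_ubound; exists y.
Qed.

Lemma ereal_inf_order_iso h S : order_iso h ->
  ereal_inf (h @` S) = h (ereal_inf S).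
Proof.
move=> [hle [h' h'K]]; apply/eqP; rewrite eq_le; apply/andP; split; last first.
  by apply: le_ereal_inf_tmp => _ [y Sy <-]; rewrite hle; exact: ereal_inf_lbound.
rewrite -[leLHS]h'K hle; apply: le_ereal_inf_tmp => y Sy.
by rewrite -hle h'K; apply: ereal_inf_lbound; exists y.
Qed.

Lemma order_iso_er_map (p q : R -> R) :
  {mono p : a b / a <= b} -> cancel q p -> order_iso (er_map p).
Proof.
move=> ple qK; split.
  by move=> [a| |] [b| |]; rewrite /er_map ?lee_fin ?ple// ?leey ?leNye.
by exists (er_map q) => -[a| |] //=; rewrite qK.
Qed.

(** What the argument uses of [limn_einf] and [limn_esup]; it makes one proof
    serve both the lower and the upper quantities. *)
Definition order_limit (L : (nat -> \bar R) -> \bar R) : Prop :=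
  [/\ forall f g, (\forall n \near \oo, f n <= g n)%E -> (L f <= L g)%E,
      forall h f, order_iso h -> L (h \o f) = h (L f) &
      forall a, L (cst a) = a].

Lemma order_limit_sandwich L h1 h2 f g :
  order_limit L -> order_iso h1 -> order_iso h2 ->
  (\forall n \near \oo, h1 (f n) <= g n <= h2 (f n))%E ->
  (h1 (L f) <= L g <= h2 (L f))%E.
Proof.
move=> [L_le L_iso _] h1iso h2iso fg; rewrite -!L_iso//.
by apply/andP; split; apply: L_le; apply: filterS fg => n /andP[].
Qed.

Lemma sdrop_comp h f n : sdrop (h \o f) n = h @` sdrop f n.
Proof. by rewrite /sdrop image_comp. Qed.

Lemma order_limit_limn_einf : order_limit (@limn_einf R).
Proof.
split=> [f g [N _ fg]|h f hiso|a].
- rewrite !limn_einf_lim; apply: lee_lim; [exact: is_cvg_einfs..|].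
  exists N => // n Nn; apply: le_ereal_inf_tmp => _ [k /= nk <-].
  apply: le_trans (fg k (leq_trans Nn nk)).
  by apply: ereal_inf_lbound; exists k.
- rewrite !limn_einf_lim !(cvg_lim _ (@cvg_einfs_sup _ _))//.
  rewrite -ereal_sup_order_iso// image_comp; congr ereal_sup.
  by apply: eq_imagel => n _; rewrite -[LHS]/(ereal_inf (sdrop (h \o f) n))
    sdrop_comp ereal_inf_order_iso.
- by have [-> _] := cvg_limn_einf_sup (@cvg_cst _ a _ _ _).
Qed.

Lemma order_limit_limn_esup : order_limit (@limn_esup R).
Proof.
split=> [f g [N _ fg]|h f hiso|a].
- rewrite !limn_esup_lim; apply: lee_lim; [exact: is_cvg_esups..|].
  exists N => // n Nn; apply: ge_ereal_sup => _ [k /= nk <-].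
  apply: le_trans (fg k (leq_trans Nn nk)) _.
  by apply: ereal_sup_ubound; exists k.
- rewrite !limn_esup_lim !(cvg_lim _ (@cvg_esups_inf _ _))//.
  rewrite -ereal_inf_order_iso// image_comp; congr ereal_inf.
  by apply: eq_imagel => n _; rewrite -[LHS]/(ereal_sup (sdrop (h \o f) n))
    sdrop_comp ereal_sup_order_iso.
- by have [_ ->] := cvg_limn_einf_sup (@cvg_cst _ a _ _ _).
Qed.

End OrderIso.

(** * Broken lines *)

Section Stretch.
Context {R : realType}.
Implicit Types (a b c C t r : R).

(** The product of [r - t] with an unknown factor between [c] and [C] is bounded
    by its products with [c] and [C], and the sign of [r - t] decides which of
    these is the upper bound; hence two slopes, one on each side of [t]. *)
Definition stretch a b t r : R := (if t <= r then a else b) * (r - t).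

Lemma stretch_mono a b t : 0 < a -> 0 < b -> {mono stretch a b t : r s / r <= s}.
Proof.
move=> a0 b0; apply: le_mono => r s rs; rewrite /stretch.
case: (leP t r) => tr; case: (leP t s) => ts.
- by rewrite ltr_pM2l// ltrD2r.
- by have := lt_trans rs ts; rewrite ltNge tr.
- apply: (@lt_le_trans _ _ 0); last by rewrite mulr_ge0 ?subr_ge0// ltW.
  by rewrite pmulr_rlt0// subr_lt0.
- by rewrite ltr_pM2l// ltrD2r.
Qed.

Lemma stretchK a b t : 0 < a -> 0 < b ->
  cancel (fun s => t + s / (if 0 <= s then a else b)) (stretch a b t).
Proof.
move=> a0 b0 s; rewrite /stretch lerDl addrAC subrr add0r.
by case: (leP 0 s) => s0; rewrite ?pmulr_lge0 ?invr_gt0// ?s0 ?(lt_geF s0) mulrC divfK// gt_eqF.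
Qed.

Lemma order_iso_stretch a b t : 0 < a -> 0 < b ->
  order_iso (er_map (stretch a b t)).
Proof.
by move=> a0 b0; apply: order_iso_er_map (stretch_mono t a0 b0) (stretchK t a0 b0).
Qed.

Lemma stretchtt a b t : stretch a b t t = 0.
Proof. by rewrite /stretch subrr mulr0. Qed.

(** For finite [K] the middle term is [(S / m) * (K / S - t)], and [S / m] is
    known up to the bounds [c] and [C]; for infinite [K] all three terms are
    [+oo]. *)
Lemma stretch_quotient (K : \bar R) (S m c C t : R) :
  (0 <= K)%E -> 0 < m -> 0 < c -> c <= S / m <= C ->
  (er_map (stretch c C t) (K / S%:E) <= (K + (- t * S)%:E) / m%:E
     <= er_map (stretch C c t) (K / S%:E))%E.
Proof.
move=> K0 m0 c0 /andP[cS SC].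
have Sm0 : 0 < S / m by exact: lt_le_trans cS.
have S0 : 0 < S by rewrite -(pmulr_lgt0 S (x := m^-1)) ?invr_gt0.
rewrite !inver !gt_eqF//; case: K K0 => [k| |]// K0; last first.
  by rewrite addye// !gt0_mulye ?lte_fin ?invr_gt0//= lexx.
rewrite -EFinD -!EFinM /= !lee_fin.
have -> : (k + - t * S) / m = (S / m) * (k / S - t).
  by field; rewrite !gt_eqF.
rewrite /stretch; case: (leP t (k / S)) => tk.
  by rewrite !ler_wpM2r ?subr_ge0.
by rewrite !ler_wnM2r// subr_le0 ltW.
Qed.

(** If [D] were infinite, so would be [P 0]; for finite [D] both bounds vanish
    at [t = D], while for [t <> D] they are both nonzero of the same sign. *)
Lemma stretch_root (D : \bar R) (P : R -> \bar R) c C :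
  0 < c -> 0 < C -> (0 <= D)%E -> (P 0%R < +oo)%E ->
  (forall t, er_map (stretch c C t) D <= P t <= er_map (stretch C c t) D)%E ->
  exists s : R, D = s%:E /\ forall t, P t = 0%E <-> t = s.
Proof.
move=> c0 C0 D0 P0 hP; case: D D0 hP => [s| |]// _ hP; last first.
  by have /andP[+ _] := hP 0; rewrite leye_eq => /eqP Py; rewrite Py in P0.
exists s; split=> // t; split=> [Pt|->]; last first.
  by have := hP s; rewrite /= !stretchtt -eq_le => /eqP.
have /andP[] := hP t; rewrite Pt !lee_fin => lo hi.
apply/eqP; rewrite eq_le.
rewrite -{1}(stretch_mono t C0 c0) stretchtt hi.
by rewrite -(stretch_mono t c0 C0) stretchtt lo.
Qed.

End Stretch.

(** * Bowen balls *)

Section Bowen.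
Context {R : realType} {X : completeMetricType R} (T : X -> X) (xs : nat -> X).
Implicit Types (x : X) (e : R) (F G : nat -> \bar R).

Lemma inf_bowen_sandwich n x e F G (h1 h2 : \bar R -> \bar R) :
  order_iso h1 -> order_iso h2 ->
  (forall i, bowen_ball T n x e (xs i) -> h1 (F i) <= G i <= h2 (F i))%E ->
  (h1 (inf_bowen T xs n x e F) <= inf_bowen T xs n x e G
     <= h2 (inf_bowen T xs n x e F))%E.
Proof.
move=> h1iso h2iso FG; rewrite /inf_bowen -!ereal_inf_order_iso// !image_comp.
apply/andP; split; apply: le_ereal_inf_tmp => _ [i xi <-];
  have /andP[lo hi] := FG i xi.
  by apply: le_trans lo; apply: ereal_inf_lbound; exists i.
by apply: le_trans hi; apply: ereal_inf_lbound; exists i.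
Qed.

Lemma sub_bowen_ball n x e e' : e <= e' ->
  bowen_ball T n x e `<=` bowen_ball T n x e'.
Proof. by move=> ee' y xy i /xy /lt_le_trans; exact. Qed.

Lemma inf_bowen_anti n x e e' F : e <= e' ->
  (inf_bowen T xs n x e' F <= inf_bowen T xs n x e F)%E.
Proof.
move=> ee'; apply: ereal_inf_le_tmp => _ [i xi <-].
by exists i => //; exact: sub_bowen_ball xi.
Qed.

Lemma birkhoffZ (a : R) (u : X -> R) n y :
  birkhoff T (fun z => a * u z) n y = a * birkhoff T u n y.
Proof. by rewrite /birkhoff mulr_sumr. Qed.

(** Admissibility gives [c] and [C] as the lower average minus, and the upper
    average plus, twice the variation; the condition that the variation is
    below half the lower average is what makes [c] positive. *)
Lemma admissible_bounds (u : X -> R) x e :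
  (0 < lower_avg T u x)%E -> (lower_avg T u x <= upper_avg T u x)%E ->
  (upper_avg T u x < +oo)%E -> admissible T xs u x e ->
  exists c C, [/\ 0 < c, 0 < C & \forall n \near \oo, forall i,
    bowen_ball T n x e (xs i) -> c <= birkhoff T u n (xs i) / n%:R <= C].
Proof.
rewrite /admissible; case: (lower_avg T u x) (upper_avg T u x) => [l| |] [v| |]//.
rewrite lte_fin lee_fin inver pnatr_eq0/= -EFinM => l0 lv _ [e0].
have : (0 <= Var u e)%E.
  (* the pair (x, x) contributes 0 to the supremum *)
  by apply: ereal_sup_ubound; exists (x, x); rewrite /= ?mdistxx ?ltW// subrr normr0.
case: (Var u e) => [w| |]//; rewrite lee_fin lte_fin => w0 wl [N xsN].
exists (l - 2 * w), (v + 2 * w); split; [lra|lra|].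
exists N => // n Nn i xi; exact: xsN.
Qed.

Section Quantities.
Variables (K : nat -> \bar R) (K_ge0 : forall i, (0 <= K i)%E).
Variables (u : X -> R) (x : X) (e c C : R).
Hypotheses (c_gt0 : 0 < c) (C_gt0 : 0 < C).
Hypothesis bounds : \forall n \near \oo, forall i,
  bowen_ball T n x e (xs i) -> c <= birkhoff T u n (xs i) / n%:R <= C.

Variables (L : (nat -> \bar R) -> \bar R) (L_lim : order_limit L).

(* With [limn_einf] or [limn_esup] for [L], the next three quantities are
   convertible to the lower or upper complexity, pressure and dimension. *)
Let complexity e' : \bar R :=
  L (fun n => inf_bowen T xs n x e' (fun i => K i / n%:R%:E)%E).
Let pressure e' t : \bar R :=
  L (fun n => inf_bowen T xs n x e' (fun i =>
    (K i + (birkhoff T (fun y => - t * u y) n (xs i))%:E) / n%:R%:E)%E).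
Let dimension e' : \bar R :=
  L (fun n => inf_bowen T xs n x e' (fun i =>
    K i / (birkhoff T u n (xs i))%:E)%E).

Let pressure0 e' : pressure e' 0 = complexity e'.
Proof.
congr L; apply/funext => n; congr inf_bowen; apply/funext => i.
by rewrite birkhoffZ oppr0 mul0r adde0.
Qed.

(** The constants [c] and [C] of the scale [e] also serve every smaller scale,
    because Bowen balls shrink with the scale; this is what lets the bounds
    pass to the limit of small scales. *)
Lemma pressure_sandwich e' t : e' <= e ->
  (er_map (stretch c C t) (dimension e') <= pressure e' t
     <= er_map (stretch C c t) (dimension e'))%E.
Proof.
move=> e'e; apply: order_limit_sandwich => //; [exact: order_iso_stretch..|].
near=> n; apply: inf_bowen_sandwich; [exact: order_iso_stretch..|] => i xi.
rewrite birkhoffZ; apply: stretch_quotient => //.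
  by rewrite ltr0n; near: n; exists 1%N.
by move: i xi; near: n; apply: filterS bounds => n + i /(sub_bowen_ball e'e); exact.
Unshelve. all: by end_near. Qed.

Lemma dimension_ge0 e' : e' <= e -> (0 <= dimension e')%E.
Proof.
move=> e'e; have [L_le _ L_cst] := L_lim.
rewrite -[leLHS]L_cst; apply: L_le; near=> n.
apply: le_ereal_inf_tmp => _ [i xi <-]; apply: mule_ge0 => //.
rewrite inve_ge0 lee_fin.
have n0 : 0 < n%:R :> R by rewrite ltr0n; near: n; exists 1%N.
have /andP[cS _] : c <= birkhoff T u n (xs i) / n%:R <= C.
  by move: i xi; near: n; apply: filterS bounds => n + i /(sub_bowen_ball e'e); exact.
by rewrite -(pmulr_lge0 (x := n%:R^-1)) ?invr_gt0// (le_trans (ltW c_gt0)).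
Unshelve. all: by end_near. Qed.

Lemma bowen_equation : (complexity e < +oo)%E ->
  exists s : R, dimension e = s%:E /\ forall t, pressure e t = 0%E <-> t = s.
Proof.
move=> Ky; apply: (@stretch_root _ _ _ c C) => //.
- exact: dimension_ge0.
- by rewrite pressure0.
- by move=> t; exact: pressure_sandwich.
Qed.

(** The limit is a supremum because smaller balls leave fewer indices to
    minimize over. Restricting it to scales below [e] keeps the uniform bounds
    available. *)
Lemma lim_at_right_bowen (F : nat -> nat -> \bar R) : 0 < e ->
  lim (L (fun n => inf_bowen T xs n x e' (F n)) @[e' --> 0^'+]) =
  ereal_sup [set L (fun n => inf_bowen T xs n x e' (F n)) | e' in [set` `]0, e[]].
Proof.
move=> e0; have [L_le _ _] := L_lim.
apply: cvg_lim => //; apply: nonincreasing_at_right_cvge => //.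
by move=> a b _ _ ab; apply: L_le; apply: nearW => n; exact: inf_bowen_anti.
Qed.

Lemma bowen_equation_lim : 0 < e ->
  (lim (complexity e' @[e' --> 0^'+]) < +oo)%E ->
  exists s : R, lim (dimension e' @[e' --> 0^'+]) = s%:E /\
    forall t, lim (pressure e' t @[e' --> 0^'+]) = 0%E <-> t = s.
Proof.
move=> e0 Ky; have lt_e e' : [set` `]0, e[] e' -> e' <= e.
  by rewrite /= in_itv/= => /andP[_ /ltW].
apply: (@stretch_root _ _ (fun t => lim (pressure e' t @[e' --> 0^'+])) c C) => //.
- rewrite lim_at_right_bowen//.
  have e2 : [set` `]0, e[] (e / 2) by rewrite /= in_itv/=; apply/andP; split; lra.
  apply: le_trans (dimension_ge0 (lt_e _ e2)) _.
  by apply: ereal_sup_ubound; exists (e / 2).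
- by rewrite (_ : pressure ^~ 0 = complexity)//; apply/funext => e'; rewrite pressure0.
- move=> t; rewrite !lim_at_right_bowen//.
  rewrite -!ereal_sup_order_iso; [|exact: order_iso_stretch..].
  rewrite !image_comp; apply/andP; split; apply: ge_ereal_sup => _ [e' e'e <-];
    have /andP[lo hi] := pressure_sandwich t (lt_e _ e'e).
    by apply: le_trans lo _; apply: ereal_sup_ubound; exists e'.
  by apply: le_trans hi _; apply: ereal_sup_ubound; exists e'.
Qed.

End Quantities.
End Bowen.

Lemma oracleK_ge0 (R : realType) U A s : (0 <= oracleK U A s :> \bar R)%E.
Proof. by apply: le_ereal_inf_tmp => _ [t _ <-]; rewrite lee_fin. Qed.

Theorem theorem4p5 (R : realType) (X : completeMetricType R)
  (xs : nat -> X) (xs_dense : dense (range xs))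
  (T : X -> X) (T_cont : continuous T)
  (u : X -> R) (u_unif : unif_continuous u)
  (U : ocode) (U_univ : universal_prefix_free U)
  (code : nat -> seq bool) (code_comp : computable_coding code)
  (A : set nat) (x : X)
  (lower_gt0 : (0 < lower_avg T u x)%E)
  (lower_le_upper : (lower_avg T u x <= upper_avg T u x)%E)
  (upper_fin : (upper_avg T u x < +oo)%E)
  (e : R) (e_adm : admissible T xs u x e) :
  let KA : nat -> \bar R := fun i => oracleK U A (code i) in
  [/\ (lowerK T xs KA x e < +oo)%E ->
        exists s : R, dimBS T xs KA u x e = s%:E /\
          forall t : R,
            lowerP T xs KA (fun y => - t * u y) x e = 0%E <-> t = s,
      (upperK T xs KA x e < +oo)%E ->
        exists s : R, DimBS T xs KA u x e = s%:E /\
          forall t : R,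
            upperP T xs KA (fun y => - t * u y) x e = 0%E <-> t = s,
      (lowerK0 T xs KA x < +oo)%E ->
        exists s : R, dimBS0 T xs KA u x = s%:E /\
          forall t : R,
            lowerP0 T xs KA (fun y => - t * u y) x = 0%E <-> t = s &
      (upperK0 T xs KA x < +oo)%E ->
        exists s : R, DimBS0 T xs KA u x = s%:E /\
          forall t : R,
            upperP0 T xs KA (fun y => - t * u y) x = 0%E <-> t = s].
Proof.
move=> KA; have KA_ge0 i : (0 <= KA i)%E by exact: oracleK_ge0.
have [c [C [c0 C0 bnd]]] :=
  admissible_bounds lower_gt0 lower_le_upper upper_fin e_adm.
have [e0 _ _] := e_adm.
have Li := @order_limit_limn_einf R; have Ls := @order_limit_limn_esup R.
split.
- exact: (bowen_equation KA_ge0 c0 C0 bnd Li).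
- exact: (bowen_equation KA_ge0 c0 C0 bnd Ls).
- exact: (bowen_equation_lim KA_ge0 c0 C0 bnd Li e0).
- exact: (bowen_equation_lim KA_ge0 c0 C0 bnd Ls e0).
Qed.
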